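(* Let $d\ge 1$, let $H$ be a $d\times d$ complex matrix that is both Hermitian and unitary, let $m\ge 1$ be an integer and let $\tau>0$. On $(\mathbb{C}^d)^{\otimes m}$ let $H_{\|}(m)=\sum_{i=1}^m H[i]$ and $H_{\#}(m)=H^{\otimes m}$, where $H[i]=I^{\otimes (i-1)}\otimes H\otimes I^{\otimes (m-i)}$. For $X\in\{\|,\#\}$ define the implementation time $$T_X=\inf\Big\{t\ge 0:\ \exists\,\lambda\in\mathbb{R},\ \exists\,\varphi\in\mathbb{R}\ \text{with}\ p\big(\lambda H_X(m)\big)\le\tau\ \text{and}\ e^{-it\lambda H_X(m)}=e^{i\varphi}H^{\otimes m}\Big\},$$ i.e. the least time needed to implement the $m$ parallel gates $H^{\otimes m}$ (up to global phase) by evolving under a rescaling of $H_X(m)$ whose energy spread is at most $\tau$. Then implementing the $m$ gates using the standard parallel Hamiltonian is $m$ times slower than using the coherent one: $T_{\|}=m\,T_{\#}$.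
   Context: For a Hermitian operator $A$ on a finite-dimensional Hilbert space, $p(A)=h_{\max}-h_{\min}$, where $h_{\max}$ and $h_{\min}$ are the largest and smallest eigenvalues of $A$. The quantity $p$ of the Hamiltonian is the energetic resource that is held fixed (bounded by $\tau$) when comparing implementations. *)

(* Defs.v *)
From HB Require Import structures.
From mathcomp Require Import all_boot all_order all_algebra.
From mathcomp Require Import spectral.
From mathcomp Require Import complex.
From mathcomp Require mxtens.
From mathcomp Require Import classical_sets boolp reals topology normedtype sequences trigo.

Set Implicit Arguments.
Unset Strict Implicit.
Unset Printing Implicit Defensive.

Import Order.TTheory GRing.Theory Num.Theory.
Import numFieldTopology.Exports numFieldNormedType.Exports.
Local Open Scope ring_scope.
Local Open Scope classical_set_scope.

Section Defs.
Variable R : realType.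
Local Notation C := R[i].

Definition kron {m n p q : nat} (A : 'M[C]_(m, n)) (B : 'M[C]_(p, q)) :
  'M[C]_(m * p, n * q) := mxtens.tensmx A B.
Definition tpow {n : nat} (A : 'M[C]_n) (k : nat) : 'M[C]_(n ^ k) :=
  mxtens.ntensmx A k.

Lemma site_dim (d m : nat) (i : 'I_m) : (d ^ i * d * d ^ (m - i.+1) = d ^ m)%N.
Proof.
by rewrite -expnSr -expnD subnKC // ltn_ord.
Qed.

(* H[i] = I^{\otimes i} \otimes H \otimes I^{\otimes (m-i-1)} (0-based site i). *)
Definition site {d : nat} (m : nat) (H : 'M[C]_d) (i : 'I_m) : 'M[C]_(d ^ m) :=
  castmx (site_dim d i, site_dim d i)
    (kron (kron (1%:M : 'M[C]_(d ^ i)) H) (1%:M : 'M[C]_(d ^ (m - i.+1)))).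

Definition Hpar {d : nat} (H : 'M[C]_d) (m : nat) : 'M[C]_(d ^ m) :=
  \sum_(i < m) site H i.

Definition Hcoh {d : nat} (H : 'M[C]_d) (m : nat) : 'M[C]_(d ^ m) := tpow H m.

Definition climn (u : nat -> C) : C :=
  Complex (limn (fun k => @complex.Re R (u k))) (limn (fun k => @complex.Im R (u k))).

Definition mxexp {n : nat} (A : 'M[C]_n) : 'M[C]_n :=
  \matrix_(i, j) climn (fun N => (\sum_(k < N) (k`!%:R)^-1 *: A ^+ k) i j).

Definition expi (phi : R) : C := Complex (cos phi) (sin phi).

(* Eigenvalues of a Hermitian matrix are real; largest/smallest eigenvalue. *)
Definition real_spectrum {n : nat} (A : 'M[C]_n) : set R :=
  [set h : R | eigenvalue A (Complex h 0)].
Definition hmax {n : nat} (A : 'M[C]_n) : R := sup (real_spectrum A).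
Definition hmin {n : nat} (A : 'M[C]_n) : R := inf (real_spectrum A).
Definition spread {n : nat} (A : 'M[C]_n) : R := hmax A - hmin A.

Definition impl_time {N : nat} (HX G : 'M[C]_N) (tau : R) : R :=
  inf [set t : R | 0 <= t /\
        exists lam phi : R,
          spread (Complex lam 0 *: HX) <= tau /\
          mxexp ((- Complex 0 1 * Complex (t * lam) 0) *: HX) = expi phi *: G].

End Defs.

(* Main.v *)
(** A Hermitian unitary [H] has eigenvalues 1 and -1, and tensor products of its
    eigenvectors diagonalise both Hamiltonians: a product vector with [k] factors
    of eigenvalue -1 has eigenvalue [m - 2k] for the parallel Hamiltonian and
    [(-1)^k] for the coherent one.  If both signs occur in the spectrum of [H],
    the spreads of the rescaled Hamiltonians are [2m|lam|] and [2|lam|], while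
    comparing the phases for [k = 0] and [k = 1] shows that in both cases the
    gate is implemented exactly when [cos (t lam) = 0], i.e. first when
    [t |lam| = pi/2].  Hence the times are [m pi / tau] and [pi / tau].  If [H]
    is scalar, both times are 0. *)

Require Import Defs.
From HB Require Import structures.
From mathcomp Require Import all_boot all_order all_algebra.
From mathcomp Require Import spectral.
From mathcomp Require Import complex.
From mathcomp Require Import classical_sets boolp reals topology normedtype sequences trigo.
From mathcomp Require Import -(notations) mxtens.
From mathcomp Require Import ring lra.

Set Implicit Arguments.
Unset Strict Implicit.
Unset Printing Implicit Defensive.

Import Order.TTheory GRing.Theory Num.Theory Num.Def.
Local Open Scope ring_scope.
Local Open Scope sesquilinear_scope.

(** * Kronecker products with explicit dimension casts *)

Section Kronecker.
Variable K : comPzRingType.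

Lemma tensmxA m n p q r s (A : 'M[K]_(m, n)) (B : 'M[K]_(p, q)) (C : 'M[K]_(r, s))
    (e1 : (m * p * r = m * (p * r))%N) (e2 : (n * q * s = n * (q * s))%N) :
  castmx (e1, e2) (tensmx (tensmx A B) C) = tensmx A (tensmx B C).
Proof.
apply/matrixP => i j; rewrite castmxE !mxE mulrA.
congr (A _ _ * B _ _ * C _ _); apply: val_inj; rewrite /= ?esymK ?modn_divl //.
- by rewrite -divnMA (mulnC r).
- by rewrite -divnMA (mulnC s).
- by rewrite modn_dvdm ?dvdn_mull.
- by rewrite modn_dvdm ?dvdn_mull.
Qed.

Lemma tens_castmxl m n m' n' p q (A : 'M[K]_(m, n)) (B : 'M[K]_(p, q))
    (e1 : m = m') (e2 : n = n')
    (f1 : (m * p = m' * p)%N) (f2 : (n * q = n' * q)%N) :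
  tensmx (castmx (e1, e2) A) B = castmx (f1, f2) (tensmx A B).
Proof. by case: _ / e1 f1 => f1; case: _ / e2 f2 => f2; rewrite !castmx_id. Qed.

Lemma tens1mx1 m n : tensmx (1%:M : 'M[K]_m) (1%:M : 'M[K]_n) = 1%:M.
Proof.
apply/matrixP => i j; case: (mxtens_indexP i) => i0 i1.
case: (mxtens_indexP j) => j0 j1; rewrite tensmxE !mxE -natrM mulnb.
by rewrite (inj_eq (can_inj (@mxtens_indexK m n))) xpair_eqE.
Qed.

Lemma tens_diag_mx m n (a : 'I_m -> K) (b : 'I_n -> K) :
  tensmx (diag_mx (\row_i a i)) (diag_mx (\row_j b j)) =
  diag_mx (\row_k (a (mxtens_unindex k).1 * b (mxtens_unindex k).2)).
Proof.
apply/matrixP => i j; case: (mxtens_indexP i) => i0 i1.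
case: (mxtens_indexP j) => j0 j1; rewrite tensmxE !mxE !mxtens_indexK.
rewrite (inj_eq (can_inj (@mxtens_indexK m n))) xpair_eqE.
by case: eqP => _; case: eqP => _ /=; rewrite ?(mulr0n, mulr1n, mulr0, mul0r).
Qed.

Lemma tensmxDr m n p q (A : 'M[K]_(m, n)) (B C : 'M[K]_(p, q)) :
  tensmx A (B + C) = tensmx A B + tensmx A C.
Proof. by apply/matrixP => i j; rewrite !mxE mulrDr. Qed.

Lemma tensmx_sumr m n p q (A : 'M[K]_(m, n)) l (F : 'I_l -> 'M[K]_(p, q)) :
  tensmx A (\sum_i F i) = \sum_i tensmx A (F i).
Proof.
apply: (big_morph (tensmx A)); last exact: tensmx0.
by move=> B C; exact: tensmxDr.
Qed.

(** The identity of size [d * p] splits off its factor of size [d], which associativity then moves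
    to the front. The dimensions [a] and [n], powers of [d] in the application, stay variables so
    that their equations can be substituted away. *)
Lemma cast_site_tens d p q n a (H : 'M[K]_d) (ea : a = (d * p)%N)
    (e : (a * d * q = d * n)%N) (e' : (p * d * q = n)%N) :
  castmx (e, e) (tensmx (tensmx (1%:M : 'M[K]_a) H) (1%:M : 'M[K]_q)) =
  tensmx (1%:M : 'M[K]_d)
    (castmx (e', e') (tensmx (tensmx (1%:M : 'M[K]_p) H) (1%:M : 'M[K]_q))).
Proof.
subst a n; rewrite castmx_id -[1%:M in LHS]tens1mx1.
have f : (d * p * d = d * (p * d))%N by rewrite mulnA.
rewrite -(castmxK f f (tensmx (tensmx _ _) H)) tensmxA.
have g : (d * (p * d) * q = d * p * d * q)%N by rewrite !mulnA.
by rewrite (tens_castmxl _ _ _ _ g g) castmx_comp tensmxA.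
Qed.

End Kronecker.

(** * Recursion of the parallel Hamiltonian in the number of sites *)

Section Sites.
Variable R : realType.
Local Notation C := R[i].
Variables (d : nat) (H : 'M[C]_d).

Lemma site_lift m (i : 'I_m.+1) :
  site H (lift (ord0 : 'I_m.+2) i) = tensmx (1%:M : 'M[C]_d) (site H i).
Proof. exact: cast_site_tens (expnS d i) _ _. Qed.

Lemma site_ord0 m :
  site H (ord0 : 'I_m.+2) = tensmx H (1%:M : 'M[C]_(d ^ m.+1)).
Proof.
rewrite /site /kron tens_scalar1mx.
have g : (d * d ^ (m.+2 - 1) = 1 * d * d ^ (m.+2 - 1))%N by rewrite mul1n.
rewrite (tens_castmxl _ _ _ _ g g) castmx_comp.
exact: castmx_id.
Qed.

(** The recursion starts from one site because [d ^ 1] reduces to [d] and [d ^ m.+2] to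
    [d * d ^ m.+1], so both sides have the same type without a cast. *)
Lemma HparSS m : Hpar H m.+2 =
  tensmx H (1%:M : 'M[C]_(d ^ m.+1)) + tensmx (1%:M : 'M[C]_d) (Hpar H m.+1).
Proof.
rewrite /Hpar big_ord_recl site_ord0 tensmx_sumr.
by congr (_ + _); apply: eq_bigr => i _; rewrite site_lift.
Qed.

Lemma Hpar1 : Hpar H 1 = H.
Proof.
rewrite /Hpar big_ord1 /site /kron tens_scalar1mx tens_mx_scalar scale1r.
by rewrite !castmx_comp; exact: castmx_id.
Qed.

End Sites.

(** * Complex limits and the exponential series at an imaginary number *)

Section MatrixExponential.
Variable R : realType.
Local Notation C := R[i].
Local Open Scope classical_set_scope.
Import numFieldTopology.Exports numFieldNormedType.Exports.

Definition ccvg (u : nat -> C) (l : C) :=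
  (fun k => complex.Re (u k)) @ \oo --> complex.Re l /\
  (fun k => complex.Im (u k)) @ \oo --> complex.Im l.

Lemma ccvg_climn (u : nat -> C) l : ccvg u l -> climn u = l.
Proof.
case: l => a b [/= ca cb]; rewrite /climn.
by congr Complex; apply: cvg_lim.
Qed.

Lemma ccvg_mull (c : C) u l : ccvg u l -> ccvg (fun k => c * u k) (c * l).
Proof.
case: c l => a b [x y] [/= cx cy]; split => /=.
- rewrite (_ : (fun k => _) =
      (fun k => a * complex.Re (u k) - b * complex.Im (u k))).
    by apply: cvgB; apply: cvgMr.
  by apply/funext => k; case: (u k).
- rewrite (_ : (fun k => _) =
      (fun k => a * complex.Im (u k) + b * complex.Re (u k))).
    by apply: cvgD; apply: cvgMr.
  by apply/funext => k; case: (u k).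
Qed.

Lemma ccvgD u v l l' : ccvg u l -> ccvg v l' -> ccvg (fun k => u k + v k) (l + l').
Proof.
case: l l' => a b [a' b'] [/= ca cb] [/= ca' cb']; split => /=.
- rewrite (_ : (fun k => _) = (fun k => complex.Re (u k) + complex.Re (v k))).
    exact: cvgD.
  by apply/funext => k; case: (u k) (v k) => ? ? [].
- rewrite (_ : (fun k => _) = (fun k => complex.Im (u k) + complex.Im (v k))).
    exact: cvgD.
  by apply/funext => k; case: (u k) (v k) => ? ? [].
Qed.

Lemma ccvg_sum n (u : 'I_n -> nat -> C) (l : 'I_n -> C) :
  (forall i, ccvg (u i) (l i)) ->
  ccvg (fun k => \sum_i u i k) (\sum_i l i).
Proof.
move=> ul; elim: n => [|n IH] in u l ul *.
  rewrite big_ord0 (_ : (fun k => _) = fun=> 0); first by split; apply: cvg_cst.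
  by apply/funext => k; rewrite big_ord0.
rewrite big_ord_recl; have -> : (fun k => \sum_i u i k) =
    (fun k => u ord0 k + \sum_i u (lift ord0 i) k).
  by apply/funext => k; rewrite big_ord_recl.
by apply: ccvgD => //; apply: IH.
Qed.

(** The parities and signs are arranged as in [cos_coeff] and [sin_coeff]. *)
Lemma imaginary_expr (x : R) k :
  (Complex 0 x) ^+ k = Complex ((~~ odd k)%:R * (-1) ^+ k./2 * x ^+ k)
                               ((odd k)%:R * (-1) ^+ k.-1./2 * x ^+ k) :> C.
Proof.
elim: k => [|k IH]; first by rewrite !expr0 /= !mul1r !mul0r.
rewrite exprS IH {IH}; case: k => [|k].
  apply/eqP; rewrite eq_complex /= ?expr0 ?expr1 !mulr1 !mul0r.
  by rewrite mulr0 mul1r subr0 add0r !eqxx.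
apply/eqP; rewrite eq_complex /= !mul0r !negbK.
by rewrite !exprS; apply/andP; split; apply/eqP; ring.
Qed.

(** Euler's formula: the real and imaginary parts of the partial sums are those of the cosine and
    sine series. *)
Lemma ccvg_expi (x : R) :
  ccvg (fun N => \sum_(k < N) (k`!%:R)^-1 * (Complex 0 x) ^+ k) (expi x).
Proof.
have E k : (k`!%:R)^-1 * (Complex 0 x) ^+ k =
    Complex (cos_coeff x k) (sin_coeff x k) :> C.
  rewrite imaginary_expr /cos_coeff /sin_coeff.
  have -> : (k`!%:R : C) = Complex (k`!%:R) 0.
    by rewrite -(rmorph_nat (real_complex R)).
  have -> : (Complex (k`!%:R) 0)^-1 = Complex (k`!%:R^-1) 0 :> C.
    by rewrite -[LHS](fmorphV (real_complex R)).
  apply/eqP; rewrite eq_complex /= !mul0r subr0 addr0.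
  by rewrite !(mulrC k`!%:R^-1) !eqxx.
split => /=.
- rewrite (_ : (fun N => _) = series (cos_coeff x)).
    by rewrite cos.unlock; exact: is_cvg_series_cos_coeff.
  apply/funext => N; rewrite /series /= big_mkord.
  by rewrite raddf_sum; apply: eq_bigr => k _; rewrite E.
- rewrite (_ : (fun N => _) = series (sin_coeff x)).
    by rewrite sin.unlock; exact: is_cvg_series_sin_coeff.
  apply/funext => N; rewrite /series /= big_mkord.
  by rewrite raddf_sum; apply: eq_bigr => k _; rewrite E.
Qed.
End MatrixExponential.

(** * Simultaneous diagonalisation of the two Hamiltonians *)

Section Diagonalisation.
Variable R : realType.
Local Notation C := R[i].

(** The rows of [P] are left eigenvectors of [A]. This intertwining form passes to sums, powers and
    tensor products by plain rewriting. *)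
Definition diagonalizes n (P : 'M[C]_n) (A : 'M[C]_n) (a : 'I_n -> C) :=
  P *m A = diag_mx (\row_i a i) *m P.

Lemma diagonalizesZ n (P A : 'M[C]_n) a c :
  diagonalizes P A a -> diagonalizes P (c *: A) (fun i => c * a i).
Proof.
rewrite /diagonalizes -scalemxAr => ->; rewrite scalemxAl; congr (_ *m _).
by apply/matrixP => i j; rewrite !mxE mulrnAr.
Qed.

Lemma diagonalizesX n (P A : 'M[C]_n) a k :
  diagonalizes P A a -> diagonalizes P (A ^+ k) (fun i => a i ^+ k).
Proof.
rewrite /diagonalizes => PA; elim: k => [|k IH].
  rewrite expr0 mulmx1 (_ : diag_mx _ = 1%:M) ?mul1mx //.
  by apply/matrixP => i j; rewrite !mxE.
rewrite exprSr [_ * _]/(_ *m _) mulmxA IH -mulmxA PA mulmxA mulmx_diag.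
by congr (diag_mx _ *m _); apply/rowP => i; rewrite !mxE exprSr.
Qed.

Lemma diagonalizesD n (P A B : 'M[C]_n) a b :
  diagonalizes P A a -> diagonalizes P B b ->
  diagonalizes P (A + B) (fun i => a i + b i).
Proof.
rewrite /diagonalizes mulmxDr => -> ->; rewrite -mulmxDl -raddfD.
by congr (diag_mx _ *m _); apply/rowP => i; rewrite !mxE.
Qed.

Lemma diagonalizes1 n (P : 'M[C]_n) : diagonalizes P 1%:M (fun=> 1).
Proof.
rewrite /diagonalizes mulmx1 (_ : diag_mx _ = 1%:M) ?mul1mx //.
by apply/matrixP => i j; rewrite !mxE.
Qed.

Lemma diagonalizes_sum n m (P : 'M[C]_n) (A : 'I_m -> 'M[C]_n) a :
  (forall k, diagonalizes P (A k) (a k)) ->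
  diagonalizes P (\sum_k A k) (fun i => \sum_k a k i).
Proof.
rewrite /diagonalizes => PA; rewrite mulmx_sumr (eq_bigr _ (fun k _ => PA k)).
rewrite -mulmx_suml -raddf_sum; congr (diag_mx _ *m _).
by apply/rowP => i; rewrite summxE !mxE; apply: eq_bigr => k _; rewrite mxE.
Qed.

Lemma diagonalizes_tens m n (P A : 'M[C]_m) (Q B : 'M[C]_n) a b :
  diagonalizes P A a -> diagonalizes Q B b ->
  diagonalizes (tensmx P Q) (tensmx A B)
    (fun k => a (mxtens_unindex k).1 * b (mxtens_unindex k).2).
Proof.
rewrite /diagonalizes => PA QB.
by rewrite tensmx_mul PA QB -tensmx_mul tens_diag_mx.
Qed.

Lemma eq_diagonalizes n (P A : 'M[C]_n) a b :
  a =1 b -> diagonalizes P A a -> diagonalizes P A b.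
Proof.
rewrite /diagonalizes => ab ->; congr (diag_mx _ *m _).
by apply/rowP => i; rewrite !mxE.
Qed.

Lemma diagonalizes_inj n (P A : 'M[C]_n) a b : P \in unitmx ->
  diagonalizes P A a -> diagonalizes P A b -> a =1 b.
Proof.
rewrite /diagonalizes => uP -> /(congr1 (mulmx^~ (invmx P))).
rewrite !mulmxK // => ab i.
by have /matrixP/(_ i i) := ab; rewrite !mxE eqxx.
Qed.

Lemma diagonalizes_eq n (P A B : 'M[C]_n) a : P \in unitmx ->
  diagonalizes P A a -> diagonalizes P B a -> A = B.
Proof.
by rewrite /diagonalizes => uP PA PB; rewrite -[A](mulKmx uP) PA -PB mulKmx.
Qed.

(** An eigenvector expanded in the rows of [P] has a nonzero coordinate, and comparing that
    coordinate identifies [c]. Conversely the rows of an invertible [P] are nonzero eigenvectors. *)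
Lemma diagonalizes_eigenvalue n (P A : 'M[C]_n) a c : P \in unitmx ->
  diagonalizes P A a -> eigenvalue A c <-> exists i, a i = c.
Proof.
rewrite /diagonalizes => uP PA; split.
- case/eigenvalueP => v vA v0.
  have w0 : v *m invmx P != 0.
    by apply: contra v0 => /eqP w0; rewrite -[v](mulmxKV uP) w0 mul0mx.
  have [i wi] : exists i, (v *m invmx P) 0 i != 0.
    apply/existsP; apply: contraNT w0; rewrite negb_exists => /forallP w0.
    by apply/eqP/rowP => i; rewrite [RHS]mxE; apply/eqP; have := w0 i; rewrite negbK.
  exists i; apply: (mulIf wi).
  have : v *m invmx P *m diag_mx (\row_i a i) = c *: (v *m invmx P).
    by rewrite -(mulmxK uP (diag_mx _)) -PA !mulmxA mulmxKV // vA scalemxAl.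
  by move=> /rowP/(_ i); rewrite mul_mx_diag !mxE mulrC.
- case=> i <-; apply/eigenvalueP; exists (row i P).
    by rewrite -row_mul PA row_mul row_diag_mx -scalemxAl -rowE mxE.
  apply/negP => /eqP Pi.
  have /rowP/(_ i) := congr1 (mulmx^~ (invmx P)) Pi.
  by rewrite -row_mul mulmxV // mul0mx !mxE eqxx => /eqP; rewrite oner_eq0.
Qed.

Lemma spread_diag n (P A : 'M[C]_n) (a : 'I_n -> R) i j : P \in unitmx ->
  diagonalizes P A (fun k => Complex (a k) 0) ->
  (forall k, a i <= a k <= a j) -> spread A = a j - a i.
Proof.
move=> uP PA ab.
have spec h : real_spectrum A h <-> exists k, a k = h.
  rewrite /real_spectrum /= (diagonalizes_eigenvalue _ uP PA).
  by split=> -[k]; [case=> <- | move=> <-]; exists k.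
have mem k : real_spectrum A (a k) by apply/spec; exists k.
rewrite /spread /hmax /hmin; congr (_ - _).
- apply/eqP; rewrite eq_le; apply/andP; split.
    by apply: ge_sup; [exists (a i) | move=> h /spec[k <-]; case/andP: (ab k)].
  by apply: ub_le_sup => //; exists (a j) => h /spec[k <-]; case/andP: (ab k).
- apply/eqP; rewrite eq_le; apply/andP; split.
    by apply: ge_inf => //; exists (a i) => h /spec[k <-]; case/andP: (ab k).
  by apply: lb_le_inf; [exists (a i) | move=> h /spec[k <-]; case/andP: (ab k)].
Qed.

(* [A] and [B] stand for the parallel and the coherent Hamiltonian on [m] sites;
   [k i] is the number of sites at which the [i]-th common eigenvector carries
   the eigenvalue -1. *)
Definition gate_diag m n (A B P : 'M[C]_n) (k : 'I_n -> nat) :=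
  [/\ P \in unitmx,
      diagonalizes P A (fun i => Complex (m%:R - (k i).*2%:R) 0),
      diagonalizes P B (fun i => (-1) ^+ k i) &
      forall i, (k i <= m)%N].

(** [H] is normal and squares to the identity, so the spectral theorem yields eigenvalues 1 and -1.
    For a count in {0, 1}, [1 - 2k] and [(-1)^k] agree, so one basis serves both clauses. *)
Lemma hermitian_unitary_diag d (H : 'M[C]_d) :
  H ^t* = H -> H \is unitarymx ->
  exists P k, gate_diag 1 H H P k.
Proof.
move=> hH uH; have HH : H *m H = 1%:M by rewrite -{2}hH; apply/unitarymxP.
have nH : H \is normalmx by apply/normalmxP; rewrite hH.
have uP := spectral_unit H.
have PH : diagonalizes (spectralmx H) H (fun i => spectral_diag H 0 i).
  rewrite /diagonalizes [in X in _ *m X](orthomx_spectralP nH) -mulmxA mulKVmx //.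
  by congr (diag_mx _ *m _); apply/rowP => i; rewrite mxE.
have D2 i : spectral_diag H 0 i ^+ 2 = 1.
  have := diagonalizesX 2 PH; rewrite expr2 [_ * _]HH => PHH.
  exact: (diagonalizes_inj uP PHH (diagonalizes1 _)).
have Dk i : (-1) ^+ (spectral_diag H 0 i != 1 : nat) = spectral_diag H 0 i.
  have /eqP := D2 i; rewrite sqrf_eq1.
  by case: eqP => [->|_ /= /eqP ->].
exists (spectralmx H), (fun i => (spectral_diag H 0 i != 1 : nat)); split => //.
- apply: eq_diagonalizes PH => i; rewrite -{1}Dk.
  case: (_ != _) => /=; apply/eqP; rewrite eq_complex /=;
    rewrite ?expr0 ?expr1 /= ?oppr0 ?eqxx ?andbT //.
  - by rewrite -[1.*2]/2%N; apply/eqP; ring.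
  - by rewrite addr0.
- exact: eq_diagonalizes PH.
- by move=> i; case: (_ != _).
Qed.

(** Tensoring with the eigenbasis of one more site adds the counts. The last two clauses prepare the
    cases where [H] is scalar and where both signs occur. *)
Lemma gate_diag_pow d (H P1 : 'M[C]_d) k1 m : (0 < d)%N ->
  gate_diag 1 H H P1 k1 ->
  exists P k, [/\ gate_diag m.+1 (Hpar H m.+1) (Hcoh H m.+1) P k,
    forall c : nat, (forall i, k1 i = c) -> forall i, k i = (m.+1 * c)%N &
    forall i0 i1, k1 i0 = 0%N -> k1 i1 = 1%N ->
      forall c, (c <= m.+1)%N -> exists i, k i = c].
Proof.
move=> d0 D1; have [uP1 PH PH' k1le] := D1.
elim: m => [|m [P [k [[uP PA PB kle] kconst ksurj]]]].
  exists P1, k1; rewrite Hpar1; split => //; first by move=> c; rewrite mul1n.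
  by move=> i0 i1 k0 k1' [|[|]] // _; [exists i0 | exists i1].
have dm0 : (0 < d ^ m.+1)%N by rewrite expn_gt0 d0.
exists (tensmx P1 P : 'M_(d ^ m.+2)).
exists (fun i : 'I_(d ^ m.+2) =>
  (k1 (@mxtens_unindex d (d ^ m.+1) i).1 +
   k (@mxtens_unindex d (d ^ m.+1) i).2)%N); split; first split.
- by apply: tensmx_unit; rewrite -?lt0n.
- rewrite HparSS.
  have := diagonalizesD (diagonalizes_tens PH (diagonalizes1 P))
            (diagonalizes_tens (diagonalizes1 P1) PA).
  apply: eq_diagonalizes => i /=.
  rewrite mulr1 mul1r; apply/eqP.
  rewrite eq_complex /= addr0 eqxx andbT doubleD natrD.
  by rewrite -(addn1 m.+1) (natrD _ m.+1); apply/eqP; ring.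
- have := diagonalizes_tens PH' PB.
  by apply: eq_diagonalizes => i /=; rewrite exprD.
- by move=> i; exact: leq_add (k1le _) (kle _).
- by move=> c kc i; rewrite (kconst c kc) kc mulSn.
(* Only the full count needs eigenvalue -1 at the new site; smaller counts are attained on the other
   sites. *)
- move=> i0 i1 k0 k1' c; rewrite leq_eqVlt => /orP[/eqP ->|].
    have [j kj] := ksurj _ _ k0 k1' m.+1 (leqnn _).
    by exists (mxtens_index (i1, j)); rewrite mxtens_indexK k1' kj.
  rewrite ltnS => cm; have [j kj] := ksurj _ _ k0 k1' c cm.
  by exists (mxtens_index (i0, j)); rewrite mxtens_indexK k0 kj.
Qed.
End Diagonalisation.

(** * Implementation time from the eigenvalues *)

Section ImplementationTime.
Variable R : realType.
Local Notation C := R[i].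
Local Open Scope classical_set_scope.

(** Each entry is a combination of the eigenvalues with coefficients depending on [P] alone, so the
    limit defining [mxexp] can be taken eigenvalue by eigenvalue. *)
Lemma diagonalizesE n (P A : 'M[C]_n) a i j : P \in unitmx ->
  diagonalizes P A a -> A i j = \sum_l invmx P i l * P l j * a l.
Proof.
move=> uP PA; rewrite -[A in LHS](mulKmx uP) PA mxE; apply: eq_bigr => l _.
by rewrite mul_diag_mx !mxE -mulrA [a l * _]mulrC.
Qed.

Lemma diagonalizes_mxexp n (P A : 'M[C]_n) (x : 'I_n -> R) : P \in unitmx ->
  diagonalizes P A (fun l => Complex 0 (x l)) ->
  diagonalizes P (mxexp A) (fun l => expi (x l)).
Proof.
move=> uP PA.
pose E := invmx P *m (diag_mx (\row_l expi (x l)) *m P).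
have PE : diagonalizes P E (fun l => expi (x l)) by exact: mulKVmx.
suff -> : mxexp A = E by [].
apply/matrixP => i j; rewrite mxE; apply: ccvg_climn.
rewrite (diagonalizesE i j uP PE).
have -> : (fun N => (\sum_(k < N) (k`!%:R)^-1 *: A ^+ k) i j) = (fun N =>
    \sum_l invmx P i l * P l j * \sum_(k < N) (k`!%:R)^-1 * Complex 0 (x l) ^+ k).
  apply/funext => N; apply: diagonalizesE => //.
  apply: diagonalizes_sum => k; apply: diagonalizesZ; exact: diagonalizesX.
by apply: ccvg_sum => l; apply: ccvg_mull; apply: ccvg_expi.
Qed.

Lemma expiD (x y : R) : expi (x + y) = expi x * expi y.
Proof.
by apply/eqP; rewrite eq_complex /= cosD sinD eqxx /= addrC.
Qed.

Lemma expi0 : expi 0 = 1 :> C.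
Proof. by rewrite /expi cos0 sin0. Qed.

Lemma expi_pi : expi pi = -1 :> C.
Proof. by apply/eqP; rewrite eq_complex /= cospi sinpi oppr0 !eqxx. Qed.

Lemma expi_mulpin k : expi (pi *+ k) = (-1) ^+ k :> C.
Proof.
elim: k => [|k IH]; first by rewrite mulr0n expi0.
by rewrite mulrSr exprSr expiD IH expi_pi.
Qed.

Lemma inf_eq_min (S : set R) s : S s -> lbound S s -> inf S = s.
Proof.
move=> Ss lS; apply/eqP; rewrite eq_le; apply/andP; split.
  by apply: ge_inf => //; exists s.
by apply: lb_le_inf => //; exists s.
Qed.

Lemma cos_eq0_pihalf (x : R) : cos x = 0 -> pi / 2 <= `|x|.
Proof.
move=> cx; rewrite leNgt; apply/negP; rewrite ltr_norml => /cos_gt0_pihalf.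
by rewrite cx ltxx.
Qed.

Section Diagonal.
Variables (n : nat) (P HX G : 'M[C]_n) (a : 'I_n -> R) (k : 'I_n -> nat).
Hypotheses (uP : P \in unitmx).
Hypothesis PX : diagonalizes P HX (fun i => Complex (a i) 0).
Hypothesis PG : diagonalizes P G (fun i => (-1) ^+ k i).

Lemma mxexp_gateP (x phi : R) :
  mxexp ((- Complex 0 1 * Complex x 0) *: HX) = expi phi *: G <->
  forall i, expi (- (x * a i)) = expi phi * (-1) ^+ k i.
Proof.
have PE : diagonalizes P (mxexp ((- Complex 0 1 * Complex x 0) *: HX))
    (fun i => expi (- (x * a i))).
  apply: diagonalizes_mxexp => //.
  apply: eq_diagonalizes (diagonalizesZ _ PX) => i.
  by apply/eqP; rewrite eq_complex /=; apply/andP; split; apply/eqP; ring.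
have PG' := diagonalizesZ (expi phi) PG.
split=> [E i|E].
  by move: PE; rewrite E => PE; exact: (diagonalizes_inj uP PE PG').
by apply: (diagonalizes_eq uP PE); apply: eq_diagonalizes PG' => i; rewrite E.
Qed.

Lemma impl_time_eq0 (tau : R) c (i : 'I_n) : 0 <= tau -> (forall i, k i = c) ->
  impl_time HX G tau = 0.
Proof.
move=> tau0 kc; apply: inf_eq_min => [|t []] //; split => //.
(* At time 0 the evolution is the identity, and the phase [pi *+ c] cancels the scalar [(-1) ^+ c]
   to which the gate reduces. *)
exists 0, (pi *+ c); split.
  have P0 : diagonalizes P (Complex 0 0 *: HX) (fun=> Complex 0 0).
    by apply: eq_diagonalizes (diagonalizesZ _ PX) => j; rewrite mul0r.
  by rewrite (spread_diag (a := fun=> 0) (i := i) (j := i) uP P0) ?subrr // => j; rewrite lexx.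
apply/mxexp_gateP => j.
rewrite !mul0r oppr0 expi0 expi_mulpin kc -exprD addnn -mul2n exprM.
by rewrite sqrrN !expr1n.
Qed.

(** The spread of the rescaled Hamiltonian is [2 * c * |lam|], and the gate forces
    [t * |lam| >= pi / 2]. Hence [c * pi <= 2 * c * t * |lam| <= t * tau], with equality at
    [lam = tau / (2 * c)]. In the hypotheses [x] stands for [t * lam]. *)
Lemma impl_time_spread (tau c : R) (lo hi : 'I_n) :
  0 < tau -> 0 < c -> a lo = - c -> a hi = c -> (forall i, `|a i| <= c) ->
  (forall x phi, (forall i, expi (- (x * a i)) = expi phi * (-1) ^+ k i) ->
    cos x = 0) ->
  (exists phi, forall i, expi (- (pi / 2 * a i)) = expi phi * (-1) ^+ k i) ->
  impl_time HX G tau = c * pi / tau.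
Proof.
move=> tau0 c0 alo ahi ac gate0 [phi0 gate1].
have spreadE lam : spread (Complex lam 0 *: HX) = 2 * c * `|lam|.
  have PL : diagonalizes P (Complex lam 0 *: HX) (fun i => Complex (lam * a i) 0).
    apply: eq_diagonalizes (diagonalizesZ _ PX) => i.
    by apply/eqP; rewrite eq_complex /=; apply/andP; split; apply/eqP; ring.
  have bnd i : - (`|lam| * c) <= lam * a i <= `|lam| * c.
    by rewrite -ler_norml normrM ler_wpM2l.
  have [l0|l0] := leP 0 lam.
    have e : `|lam| = lam by rewrite ger0_norm.
    rewrite (spread_diag (i := lo) (j := hi) uP PL) ?alo ?ahi ?e; first by ring.
    by move=> i; have := bnd i; rewrite e mulrN.
  (* A negative [lam] swaps the lowest and highest levels. *)
  have e : `|lam| = - lam by rewrite ltr0_norm.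
  rewrite (spread_diag (i := hi) (j := lo) uP PL) ?alo ?ahi ?e; first by ring.
  by move=> i; have := bnd i; rewrite e mulrN mulNr opprK.
apply: inf_eq_min => [|t].
- split; first by rewrite divr_ge0 ?mulr_ge0 ?pi_ge0 // ltW.
  have tl : c * pi / tau * (tau / (2 * c)) = pi / 2.
    by field; rewrite !gt_eqF.
  exists (tau / (2 * c)), phi0; split; last by rewrite tl; apply/mxexp_gateP.
  rewrite spreadE ger0_norm; last by rewrite divr_ge0 ?mulr_ge0 // ltW.
  by rewrite mulrC divfK // mulf_neq0 // gt_eqF.
- case=> t0 [lam [phi [sp /mxexp_gateP /gate0 /cos_eq0_pihalf]]].
  rewrite normrM (ger0_norm t0) => tl; rewrite spreadE in sp.
  rewrite ler_pdivrMr //.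
  have := ler_wpM2l t0 sp; have := ler_wpM2l (ltW c0) tl; lra.
Qed.

End Diagonal.
End ImplementationTime.

(** * Comparison of the two times *)

Theorem mainTheorem2 (R : realType) (d m : nat) (H : 'M[R[i]]_d) (tau : R) :
  (0 < d)%N -> (0 < m)%N ->
  H ^t* = H -> H \is unitarymx -> 0 < tau ->
  impl_time (Hpar H m) (Hcoh H m) tau = m%:R * impl_time (Hcoh H m) (Hcoh H m) tau.
Proof.
move=> d0; case: m => // m _ hH uH tau0.
have [P1 [k1 D1]] := hermitian_unitary_diag hH uH.
have [P [k [[uP PA PB kle] kconst ksurj]]] := gate_diag_pow m d0 D1.
pose s i : R := (-1) ^+ k i.
have PB' : diagonalizes P (Hcoh H m.+1) (fun i => Complex (s i) 0).
  by apply: eq_diagonalizes PB => i; exact/esym/(rmorph_sign (real_complex R)).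
(* A constant count makes the gate scalar, so both times vanish. *)
have scalar c : (forall j, k1 j = c) -> impl_time (Hpar H m.+1) (Hcoh H m.+1) tau =
    m.+1%:R * impl_time (Hcoh H m.+1) (Hcoh H m.+1) tau.
  move=> /kconst kc.
  have i : 'I_(d ^ m.+1) by apply: (@Ordinal _ 0); rewrite expn_gt0 d0.
  rewrite (impl_time_eq0 uP PA PB i _ kc) ?ltW //.
  by rewrite (impl_time_eq0 uP PB' PB i _ kc) ?ltW // mulr0.
have k1le j : (k1 j <= 1)%N by case: D1.
have [/existsP[i0 /eqP ki0]|] := boolP [exists i, k1 i == 0%N]; last first.
  rewrite negb_exists => /forallP n0; apply: (scalar 1%N) => j.
  by move: (n0 j) (k1le j); case: (k1 j) => [|[|]].
have [/existsP[i1 /eqP ki1]|] := boolP [exists i, k1 i == 1%N]; last first.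
  rewrite negb_exists => /forallP n1; apply: (scalar 0%N) => j.
  by move: (n1 j) (k1le j); case: (k1 j) => [|[|]].
(* Counts 0 and [m.+1] give the extreme levels of the parallel Hamiltonian, counts 0 and 1 those of
   the coherent one. Counts 0 and 1 also provide the phase comparison in both cases. *)
have [j0 kj0] := ksurj _ _ ki0 ki1 0%N isT.
have [j1 kj1] := ksurj _ _ ki0 ki1 1%N isT.
have [jm kjm] := ksurj _ _ ki0 ki1 m.+1 (leqnn _).
rewrite (impl_time_spread (c := m.+1%:R) (lo := jm) (hi := j0) uP PA PB) ?ltr0n //.
- rewrite (impl_time_spread (c := 1) (lo := j1) (hi := j0) uP PB' PB) ?ltr01 //.
  + by rewrite mul1r mulrA.
  + by rewrite /s kj1 expr1.
  + by rewrite /s kj0 expr0.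
  + by move=> i; rewrite /s normrX normrN1 expr1n.
  (* Real parts at the levels 1 and -1 give [cos x = cos phi] and [cos x = - cos phi]. *)
  + move=> x phi E; have := E j0; have := E j1; rewrite /s kj0 kj1 expr0 expr1.
    rewrite !mulr1 mulrN1 opprK mulrN1 => -[c1 _] [c0 _].
    by move: c0 c1; rewrite cosN; lra.
  + exists (- (pi / 2)) => i; rewrite /s -[in LHS]signr_odd -[in RHS]signr_odd.
    case: odd; last by rewrite /= !mulr1.
    rewrite !expr1 [pi / 2 * -1]mulrN1 opprK -expi_pi -expiD; congr expi; lra.
- by rewrite kjm -addnn natrD; ring.
- by rewrite kj0 subr0.
- move=> i; rewrite ler_norml; have := kle i; rewrite -(ler_nat R) -addnn natrD => ki.
  by have := ler0n R (k i); lra.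
(* The levels for counts 0 and 1 differ by 2 while the gate changes sign, so [expi (x *+ 2) = -1];
   the double-angle formula then gives [cos x = 0]. *)
- move=> x phi E; have := E j0; have := E j1.
  rewrite kj0 kj1 expr0 expr1 mulr1 mulrN1.
  move=> e1 e0; rewrite -e0 in e1.
  have : expi (x *+ 2) = -1.
    have -> : x *+ 2 = - (x * (m.+1%:R - 1.*2%:R)) + x * m.+1%:R.
      by rewrite -[1.*2]/2%N; ring.
    by rewrite expiD e1 subr0 mulNr -expiD addNr expi0.
  case=> + _; rewrite cos_mulr2n => c2.
  have /eqP : cos x ^+ 2 = 0 by lra.
  by rewrite sqrf_eq0 => /eqP.
(* At [x = pi / 2] the level [m.+1 - 2k] has phase [- (pi / 2) * m.+1 + pi * k]: the first term is
   global, the second is the gate sign. *)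
- exists (- (pi / 2 * m.+1%:R)) => i; rewrite -expi_mulpin -expiD; congr expi.
  by rewrite -addnn natrD -mulr_natr; field.
Qed.
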